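(* Let $\mathcal K$ be a flag simplicial complex of dimension $n$ with $f$-vector $(f_0,\dots,f_n)$, and set $f_i=0$ for $i>n$. Write \[ \Biggl(1+\sum_{i=0}^{n}(-1)^{i+1}f_i\frac{t^{i+1}}{(1+t)^{i+1}}\Biggr)^{-1}=1+s_1t+s_2t^2+\cdots \] as a formal power series. Then for every integer $N\ge1$ the sequence $\underline{s}=(s_1,s_2,\dots)$ satisfies $(-1)^{N+1}\sum_{d\mid N}\mu(N/d)\,p_d(\underline{s})\ge 0$. Specifically, for every integer $N\ge 1$, \[ (-1)^{N}\sum_{d\mid N}\mu(N/d)\,(-1)^d\,p_d(\underline{\alpha})\ge 0, \] where $\underline{\alpha}=(\alpha_1,\alpha_2,\dots)$ with $\alpha_m:=\sum_{i=0}^{m-1}f_i\binom{m-1}{i}$ for $m\ge1$.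
   Context: A simplicial complex $\mathcal K$ on vertex set $[m]=\{1,\dots,m\}$ is a collection of subsets of $[m]$ closed under taking subsets, containing every one-element subset; the dimension of a simplex $\sigma$ is $|\sigma|-1$, and $f_i$ is the number of $i$-dimensional simplices. A minimal non-face is a subset $\sigma\notin\mathcal K$ all of whose proper subsets lie in $\mathcal K$; $\mathcal K$ is flag if all its minimal non-faces have exactly two elements. Sums $\sum_{d\mid N}$ run over positive divisors $d$ of $N$; $\mu$ is the M\''obius function ($\mu(n)=(-1)^k$ if $n$ is a product of $k$ distinct primes, $0$ otherwise). For a sequence $\underline{x}=(x_1,x_2,\dots)$, $p_d(\underline{x})$ is the unique polynomial in $x_1,\dots,x_d$ such that whenever $x_i=\sigma_i(\gamma_1,\dots,\gamma_M)$ are the elementary symmetric polynomials in variables $\gamma_1,\dots,\gamma_M$ ($M\ge d$), $p_d(\underline{x})=\gamma_1^d+\cdots+\gamma_M^d$ (the $d$-th Newton power sum expressed in elementary symmetric polynomials; e.g. $p_1=x_1$, $p_2=x_1^2-2x_2$, $p_3=x_1^3-3x_1x_2+3x_3$). *)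

(* Defs.v *)
From HB Require Import structures.
From mathcomp Require Import all_boot all_order all_algebra.
From mathcomp Require Import mpoly.

Set Implicit Arguments.
Unset Strict Implicit.
Unset Printing Implicit Defensive.

Import Order.TTheory GRing.Theory Num.Theory.
Local Open Scope ring_scope.

(* The vertex set [m] = {1, ..., m} is 'I_m. *)
Section SimplicialComplexes.
Variable m : nat.
Implicit Types (K : {set {set 'I_m}}) (s t : {set 'I_m}).

Definition simplicial_complex K : Prop :=
  (forall s t, s \in K -> t \subset s -> t \in K) /\
  (forall i : 'I_m, [set i] \in K).

(* A simplex of dimension n has n + 1 elements. *)
Definition complex_dim K (n : nat) : Prop := (\max_(s in K) #|s| = n.+1)%N.

Definition fvec K (i : nat) : nat := #|[set s in K | #|s| == i.+1]|.

Definition minimal_nonface K s : Prop :=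
  s \notin K /\ forall t, t \proper s -> t \in K.

Definition flag K : Prop := forall s, minimal_nonface K s -> #|s| = 2%N.

End SimplicialComplexes.

Definition mobius (n : nat) : int :=
  if (0 < n)%N && all (fun p => logn p n == 1%N) (primes n)
  then (-1) ^+ size (primes n) else 0.

(* A formal power series over R is its sequence of coefficients. *)
Section PowerSeries.
Variable R : comUnitRingType.
Implicit Types (a b : nat -> R) (p : {poly R}).

Definition fps_poly p : nat -> R := fun n => p`_n.

Definition fps_mul a b : nat -> R := fun n => \sum_(k < n.+1) a k * b (n - k)%N.

(* The coefficients 0, ..., n of the inverse of a, from b_0 = a_0^-1 and
   a_0 b_n.+1 = - (a_1 b_n + ... + a_n.+1 b_0). *)
Fixpoint fps_inv_seq a (n : nat) : seq R :=
  if n is n'.+1 then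
    let s := fps_inv_seq a n' in
    rcons s (- (a 0%N)^-1 * \sum_(k < n) a k.+1 * s`_(n' - k))
  else [:: (a 0%N)^-1].

Definition fps_inv a : nat -> R := fun n => (fps_inv_seq a n)`_n.

Lemma size_fps_inv_seq a n : size (fps_inv_seq a n) = n.+1.
Proof. by elim: n => //= n IHn; rewrite size_rcons IHn. Qed.

Lemma nth_fps_inv_seq a n k : (k <= n)%N -> (fps_inv_seq a n)`_k = fps_inv a k.
Proof.
elim: n => [|n IHn]; first by rewrite leqn0 => /eqP ->.
rewrite leq_eqVlt => /orP[/eqP -> //|]; rewrite ltnS => le_kn.
by rewrite /= nth_rcons size_fps_inv_seq ltnS le_kn IHn.
Qed.

Lemma fps_invS a n :
  fps_inv a n.+1 = - (a 0%N)^-1 * \sum_(k < n.+1) a k.+1 * fps_inv a (n - k)%N.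
Proof.
rewrite {1}/fps_inv /= nth_rcons size_fps_inv_seq ltnn eqxx; congr (_ * _).
by apply: eq_bigr => k _; rewrite nth_fps_inv_seq // leq_subr.
Qed.

Lemma fps_mulV a : a 0%N \is a GRing.unit ->
  fps_mul a (fps_inv a) =1 fps_poly 1.
Proof.
move=> a0U [|n]; rewrite /fps_mul /fps_poly coef1 big_ord_recl.
  by rewrite big_ord0 addr0 /fps_inv /= mulrV.
rewrite subn0 fps_invS mulNr mulrN mulrA mulrV // mul1r.
by apply/eqP; rewrite addrC subr_eq0; apply/eqP/eq_bigr.
Qed.

End PowerSeries.

Section NewtonPolynomials.

(* mesym M int i is the i-th elementary symmetric polynomial in M variables;
   the variable 'X_i of p (i < d) stands for x_(i+1). *)
Definition is_newton_poly (d : nat) (p : {mpoly int[d]}) : Prop :=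
  forall M : nat, (d <= M)%N ->
    p \mPo [tuple mesym M int i.+1 | i < d] = \sum_(j < M) 'X_j ^+ d.

Section NewtonIdentity.
Variable M : nat.
Local Notation E := (mesym M int).
Local Notation A := {mpoly int[M]}.

Let Ej (j : 'I_M) (k : nat) : A :=
  \sum_(h : {set 'I_M} | (#|h| == k) && (j \notin h)) \prod_(i in h) 'X_i.

Let EjS j k :
  \sum_(h : {set 'I_M} | (#|h| == k.+1) && (j \in h)) \prod_(i in h) 'X_i
  = 'X_j * Ej j k :> A.
Proof.
rewrite mulr_sumr (reindex_onto (fun h => j |: h) (fun h => h :\ j)) /=; last first.
  by move=> h /andP[_ jh]; rewrite setD1K.
apply: eq_big => [h|h].
  rewrite setU11 andbT; apply/andP/andP => [[ch /eqP hj]|[ch jh]].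
    have jh : j \notin h by rewrite -hj setD11.
    by move: ch; rewrite cardsU1 jh.
  by rewrite cardsU1 jh (eqP ch) setU1K.
move=> /andP[_ /eqP hj]; have jh : j \notin h by rewrite -hj setD11.
by rewrite big_setU1.
Qed.

Let EE j k : E k.+1 = 'X_j * Ej j k + Ej j k.+1.
Proof. by rewrite -EjS /mesym (bigID (fun h : {set 'I_M} => j \in h)). Qed.

Let Ej0 j : Ej j 0 = 1.
Proof.
rewrite /Ej (big_pred1 set0) ?big_set0 // => h.
by rewrite /= cards_eq0; case: eqP => [->|//]; rewrite in_set0.
Qed.

Let EjE j k :
  'X_j * Ej j k = \sum_(i < k.+1) (-1) ^+ i * 'X_j ^+ i.+1 * E (k - i)%N.
Proof.
elim: k => [|k IHk].
  by rewrite Ej0 big_ord1 expr0 expr1 mul1r subnn mesym0E.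
rewrite big_ord_recl expr0 expr1 mul1r subn0 (EE j k) mulrDr addrAC.
rewrite -[LHS]add0r; congr (_ + _); apply/esym/eqP; rewrite addr_eq0; apply/eqP.
rewrite IHk mulr_sumr -sumrN; apply: eq_bigr => i _.
rewrite lift0 subSS [(-1) ^+ _.+1]exprS ['X_j ^+ i.+2]exprS mulN1r !mulNr opprK.
by rewrite mulrA [X in X * _]mulrCA.
Qed.

Lemma newton_identity k :
  E k.+1 *+ k.+1 =
  \sum_(i < k.+1) (-1) ^+ i * (\sum_(j < M) 'X_j ^+ i.+1) * E (k - i)%N.
Proof.
transitivity (\sum_(j < M) 'X_j * Ej j k).
  under eq_bigr do rewrite -EjS.
  rewrite (exchange_big_dep (fun h : {set 'I_M} => #|h| == k.+1)) /=; last first.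
    by move=> j h _ /andP[].
  rewrite /mesym -sumrMnl; apply: eq_bigr => h /eqP ch.
  by rewrite -ch -sumr_const; apply: eq_bigl => j; rewrite eqxx.
under eq_bigr do rewrite EjE.
rewrite exchange_big /=; apply: eq_bigr => i _.
by rewrite -mulr_suml -mulr_sumr.
Qed.

End NewtonIdentity.

Let newton_rec (d k : nat) : {q : nat -> {mpoly int[d]} |
  forall i, (i < k)%N -> (i < d)%N -> forall M,
    q i \mPo [tuple mesym M int i.+1 | i < d] = \sum_(j < M) 'X_j ^+ i.+1}.
Proof.
pose x i : {mpoly int[d]} := if insub i is Some j then 'X_j else 0.
elim: k => [|k [q Hq]]; first by exists (fun=> 0).
pose r := (-1) ^+ k * (x k *+ k.+1
  - \sum_(i < k) (-1) ^+ i * q i * x (k - i.+1)%N).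
exists (fun i => if i == k then r else q i) => i; rewrite ltnS leq_eqVlt.
case: eqP => [-> _|_ /= lt_ik]; last exact: Hq.
move=> lt_kd M.
have xE i' : (i' < d)%N ->
    x i' \mPo [tuple mesym M int i.+1 | i < d] = mesym M int i'.+1.
  move=> lt_i'd; rewrite /x insubT comp_mpolyXU -tnth_nth tnth_mktuple //.
rewrite /r !rmorphM rmorphB rmorphMn rmorph_sum /= !rmorphXn /= rmorphN1 xE //.
rewrite newton_identity big_ord_recr /= subnn mesym0E mulr1.
under [X in _ - X]eq_bigr => j _.
  rewrite !rmorphM rmorphXn rmorphN1 /= Hq ?(ltn_trans (ltn_ord j) lt_kd) //.
  rewrite xE ?(leq_ltn_trans (leq_subr _ _)) // subnSK //.
  over.
by rewrite addrAC subrr add0r mulrA -exprD addnn -mul2n exprM sqrrN !expr1n mul1r.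
Qed.

(* For d = 0 the right-hand side is M, so no single polynomial works. *)
Lemma newton_poly_exists (d : nat) :
  {p : {mpoly int[d]} | (0 < d)%N -> is_newton_poly p}.
Proof.
case: d => [|d]; first by exists 0.
have [q Hq] := newton_rec d.+1 d.+1.
by exists (q d) => _ M _; apply: Hq.
Qed.

Lemma newton_poly_unique (d : nat) (p q : {mpoly int[d]}) :
  is_newton_poly p -> is_newton_poly q -> p = q.
Proof.
move=> Hp Hq; apply: msym_fundamental_un.
by rewrite (Hp d (leqnn d)) (Hq d (leqnn d)).
Qed.

Definition newton_poly (d : nat) : {mpoly int[d]} := sval (newton_poly_exists d).

Lemma newton_polyP (d : nat) : (0 < d)%N -> is_newton_poly (newton_poly d).
Proof. exact: (svalP (newton_poly_exists d)). Qed.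

(* p_d(x_1, x_2, ...); the value x 0 is not used. *)
Definition psum (d : nat) (x : nat -> int) : int :=
  (newton_poly d).@[fun i : 'I_d => x i.+1].

End NewtonPolynomials.

(* 1 + \sum_(0 <= i <= n) (-1)^(i+1) f_i t^(i+1) / (1 + t)^(i+1); its inverse is
   1 + s_1 t + s_2 t^2 + ... (see sseq0 for the constant coefficient). *)
Definition fseries (m : nat) (K : {set {set 'I_m}}) (n : nat) : nat -> int :=
  fun k => fps_poly 1 k +
    \sum_(i < n.+1) (-1) ^+ i.+1 * (fvec K i)%:Z *
      fps_mul (fps_poly 'X^(i.+1)) (fps_inv (fps_poly ((1 + 'X) ^+ i.+1))) k.

Definition sseq (m : nat) (K : {set {set 'I_m}}) (n : nat) : nat -> int :=
  fps_inv (fseries K n).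

Lemma fseries0 (m : nat) (K : {set {set 'I_m}}) (n : nat) : fseries K n 0 = 1.
Proof.
rewrite /fseries /fps_mul /fps_poly coef1 big1 ?addr0 // => i _.
by rewrite big_ord1 coefXn mul0r mulr0.
Qed.

Lemma sseq0 (m : nat) (K : {set {set 'I_m}}) (n : nat) : sseq K n 0 = 1.
Proof. by rewrite /sseq /fps_inv /= fseries0 invr1. Qed.

Definition alpha (m : nat) (K : {set {set 'I_m}}) (k : nat) : nat :=
  (\sum_(i < k) fvec K i * 'C(k.-1, i))%N.

(* Main.v *)
Require Import Defs.
From HB Require Import structures.
From mathcomp Require Import all_boot all_order all_algebra.
From mathcomp Require Import mpoly.
From mathcomp Require Import boolp ring.

Set Implicit Arguments.
Unset Strict Implicit.
Unset Printing Implicit Defensive.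

Import Order.TTheory GRing.Theory Num.Theory.
Local Open Scope ring_scope.

(** Write F(t) for the series inverted in the statement, so that F(-t) is
1 + alpha_1 t + alpha_2 t^2 + ... and 1 / F is 1 + s_1 t + s_2 t^2 + .... By
Newton's identities the logarithmic derivative t a'(t) / a(t) of a series a with
constant term 1 is p_1(a) t - p_2(a) t^2 + p_3(a) t^3 - ..., hence
p_d(s) = (-1)^(d-1) p_d(alpha) and both inequalities are the same. Their
left-hand side turns products of series into sums, and by Moebius inversion it
equals N l_N when 1 / F is the product of (1 + t^j)^(l_j) over odd j and of
(1 - t^j)^(- l_j) over even j; we need l_N >= 0.

For a set U of vertices let F_U be the sum of (- t / (1 + t))^|s| over the
simplices s contained in U. Flagness gives, for v in U with link L in U - v,
F_U = F_(U - v) - t / (1 + t) F_L. With H = F_L / F_(U - v) this reads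
(1 + t) F_U = F_(U - v) (1 - t (H - 1)). By induction H has nonnegative
coefficients and constant term 1, so 1 / F_U is 1 / F_(U - v) times 1 + t times
1 / (1 - B) with B nonnegative, and 1 / (1 - B), the Hilbert series of a tensor
algebra, is decomposed into the required factors by Lazard elimination. *)

(** * Formal power series *)

Record fps (R : comUnitRingType) := Fps { fps_coef :> nat -> R }.

Section FpsRing.
Variable R : comUnitRingType.
Implicit Types a b c : fps R.

HB.instance Definition _ := gen_eqMixin (fps R).
HB.instance Definition _ := gen_choiceMixin (fps R).

Lemma fpsP a b : a =1 b -> a = b.
Proof. by case: a b => [a] [b] /= /funext ->. Qed.

Definition fps_zero : fps R := Fps (fun=> 0).
Definition fps_add a b := Fps (fun n => a n + b n).
Definition fps_opp a := Fps (fun n => - a n).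

Lemma fps_addA : associative fps_add.
Proof. by move=> a b c; apply: fpsP => n /=; rewrite addrA. Qed.

Lemma fps_addC : commutative fps_add.
Proof. by move=> a b; apply: fpsP => n /=; rewrite addrC. Qed.

Lemma fps_add0 : left_id fps_zero fps_add.
Proof. by move=> a; apply: fpsP => n /=; rewrite add0r. Qed.

Lemma fps_addN : left_inverse fps_zero fps_opp fps_add.
Proof. by move=> a; apply: fpsP => n /=; rewrite addNr. Qed.

HB.instance Definition _ :=
  GRing.isZmodule.Build (fps R) fps_addA fps_addC fps_add0 fps_addN.

Definition fps_one := Fps (fun n => (n == 0%N)%:R : R).
Definition fps_mult a b := Fps (fps_mul a b).

Let trunc N (a : nat -> R) : {poly R} := \poly_(i < N.+1) a i.

Let fps_mul_trunc N (a b : nat -> R) n : (n <= N)%N ->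
  fps_mul a b n = (trunc N a * trunc N b)`_n.
Proof.
move=> nN; rewrite coefM; apply: eq_bigr => k _; rewrite !coef_poly !ltnS.
by rewrite (leq_trans (leq_subr _ _) nN) (leq_trans _ nN) // -ltnS.
Qed.

Lemma fps_mulC : commutative fps_mult.
Proof.
by move=> a b; apply: fpsP => n /=; rewrite !(@fps_mul_trunc n) // mulrC.
Qed.

Lemma fps_mulA : associative fps_mult.
Proof.
move=> a b c; apply: fpsP => n /=.
transitivity ((trunc n a * (trunc n b * trunc n c))`_n).
  rewrite coefM; apply: eq_bigr => k _.
  by rewrite coef_poly ltn_ord (@fps_mul_trunc n) // leq_subr.
rewrite mulrA coefM; apply: eq_bigr => k _.
by rewrite [in RHS](@fps_mul_trunc n) -1?ltnS // coef_poly ltnS leq_subr.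
Qed.

Lemma fps_mul1 : left_id fps_one fps_mult.
Proof.
move=> a; apply: fpsP => n /=; rewrite /fps_mul big_ord_recl /= mul1r subn0.
by rewrite big1 ?addr0 // => i _; rewrite mul0r.
Qed.

Lemma fps_mulDl : left_distributive fps_mult fps_add.
Proof.
move=> a b c; apply: fpsP => n /=; rewrite /fps_mul -big_split /=.
by apply: eq_bigr => i _; rewrite mulrDl.
Qed.

Lemma fps_one_neq0 : fps_one != 0.
Proof.
by apply/eqP => /(congr1 (fun a : fps R => a 0%N)) /= /eqP; rewrite oner_eq0.
Qed.

HB.instance Definition _ := GRing.Zmodule_isComNzRing.Build (fps R)
  fps_mulA fps_mulC fps_mul1 fps_mulDl fps_one_neq0.

Lemma coef_fpsD a b n : (a + b) n = a n + b n. Proof. by []. Qed.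
Lemma coef_fpsN a n : (- a) n = - a n. Proof. by []. Qed.
Lemma coef_fps1 n : (1 : fps R) n = (n == 0%N)%:R. Proof. by []. Qed.
Lemma coef_fpsM a b n : (a * b) n = \sum_(k < n.+1) a k * b (n - k)%N.
Proof. by []. Qed.

Lemma coef_fpsM0 a b : (a * b) 0%N = a 0%N * b 0%N.
Proof. by rewrite coef_fpsM big_ord1. Qed.

Lemma coef_fps_sum I (r : seq I) (P : pred I) (F : I -> fps R) n :
  (\sum_(i <- r | P i) F i) n = \sum_(i <- r | P i) F i n.
Proof. by elim/big_rec2: _ => // i x y _ <-. Qed.

Lemma coef_fpsMn a j n : (a *+ j) n = a n *+ j.
Proof. by elim: j => // j IHj; rewrite !mulrS coef_fpsD IHj. Qed.

Definition fps_unit : pred (fps R) := fun a => a 0%N \is a GRing.unit.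
Definition fps_invr a := if fps_unit a then Fps (fps_inv a) else a.

Lemma fps_mulVr : {in fps_unit, left_inverse 1 fps_invr *%R}.
Proof.
move=> a aU; rewrite /fps_invr ifT // mulrC; apply: fpsP => n.
by rewrite coef_fps1 -coef1; apply: fps_mulV.
Qed.

Lemma fps_unitPl a b : b * a = 1 -> fps_unit a.
Proof.
move=> /(congr1 (fun c : fps R => c 0%N)); rewrite coef_fpsM0 => ba1.
by apply/unitrPr; exists (b 0%N); rewrite mulrC.
Qed.

Lemma fps_invr_out : {in [predC fps_unit], fps_invr =1 id}.
Proof. by move=> a /negPf aU; rewrite /fps_invr ifF. Qed.

HB.instance Definition _ := GRing.ComNzRing_hasMulInverse.Build (fps R)
  fps_mulVr fps_unitPl fps_invr_out.

Lemma unit_fpsE a : (a \is a GRing.unit) = (a 0%N \is a GRing.unit).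
Proof. by []. Qed.

Lemma unit_fps1 a : a 0%N = 1 -> a \is a GRing.unit.
Proof. by rewrite unit_fpsE => ->; apply: unitr1. Qed.

Lemma fps_invE a : a \is a GRing.unit -> a^-1 = Fps (fps_inv a).
Proof. by move=> aU; rewrite /GRing.inv /= /fps_invr ifT. Qed.

Definition fps_of_poly (p : {poly R}) : fps R := Fps (fps_poly p).

Lemma fps_of_poly_is_zmod_morphism : zmod_morphism fps_of_poly.
Proof. by move=> p q; apply: fpsP => n; apply: coefB. Qed.

Lemma fps_of_poly_is_monoid_morphism : monoid_morphism fps_of_poly.
Proof. by split=> [|p q]; apply: fpsP => n; [apply: coef1 | apply: coefM]. Qed.

HB.instance Definition _ := GRing.isZmodMorphism.Build {poly R} (fps R)
  fps_of_poly fps_of_poly_is_zmod_morphism.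
HB.instance Definition _ := GRing.isMonoidMorphism.Build {poly R} (fps R)
  fps_of_poly fps_of_poly_is_monoid_morphism.

Definition fpsX : fps R := fps_of_poly 'X.

Lemma coef_fpsX n : fpsX n = (n == 1%N)%:R.
Proof. exact: coefX. Qed.

Lemma coef_fpsXn k n : (fpsX ^+ k) n = (n == k)%:R.
Proof. by rewrite -rmorphXn -coefXn. Qed.

Lemma coef_fpsXM a n : (fpsX * a) n = if n is n'.+1 then a n' else 0.
Proof.
case: n => [|n]; first by rewrite coef_fpsM0 coef_fpsX mul0r.
rewrite coef_fpsM 2!big_ord_recl !coef_fpsX mul0r mul1r subSS subn0 add0r.
by rewrite big1 ?addr0 // => i _; rewrite coef_fpsX mul0r.
Qed.

Lemma coef_fpsXnM k a n :
  (fpsX ^+ k * a) n = if (n < k)%N then 0 else a (n - k)%N.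
Proof.
elim: k n => [|k IHk] n; first by rewrite mul1r subn0.
by rewrite exprS -mulrA coef_fpsXM; case: n => // n; rewrite IHk.
Qed.

Lemma coef_fpsV0 a : a^-1 0%N = (a 0%N)^-1.
Proof.
have [aU|aU] := boolP (a \is a GRing.unit); first by rewrite fps_invE.
by rewrite !invr_out.
Qed.

Lemma unit_fps_1DX : 1 + fpsX \is a GRing.unit.
Proof. by rewrite unit_fps1 // coef_fpsD coef_fpsX addr0. Qed.

Lemma unit_fps_1BXM a : 1 - fpsX * a \is a GRing.unit.
Proof. by rewrite unit_fps1 // coef_fpsD coef_fpsN coef_fpsXM subr0. Qed.

Lemma unit_fps_1BXn k : (0 < k)%N -> 1 - fpsX ^+ k \is a GRing.unit.
Proof. by case: k => // k _; rewrite exprS unit_fps_1BXM. Qed.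

End FpsRing.

Arguments fpsX {R}.

Section SignTwist.
Variable R : comUnitRingType.

Definition fps_twist (a : fps R) : fps R := Fps (fun n => (-1) ^+ n * a n).

Lemma coef_fps_twist a n : fps_twist a n = (-1) ^+ n * a n.
Proof. by []. Qed.

Lemma fps_twist_is_zmod_morphism : zmod_morphism fps_twist.
Proof. by move=> a b; apply: fpsP => n; apply: mulrBr. Qed.

Lemma fps_twist_is_monoid_morphism : monoid_morphism fps_twist.
Proof.
split=> [|a b]; apply: fpsP => n.
  by case: n => [|n] /=; rewrite ?mul1r ?mulr0.
rewrite coef_fpsM /= /fps_mul mulr_sumr; apply: eq_bigr => i _.
have -> : (-1) ^+ n = (-1) ^+ i * (-1) ^+ (n - i) :> R.
  by rewrite -exprD subnKC // -ltnS.
by rewrite mulrACA.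
Qed.

HB.instance Definition _ := GRing.isZmodMorphism.Build (fps R) (fps R)
  fps_twist fps_twist_is_zmod_morphism.
HB.instance Definition _ := GRing.isMonoidMorphism.Build (fps R) (fps R)
  fps_twist fps_twist_is_monoid_morphism.

Lemma fps_twistX : fps_twist fpsX = - fpsX.
Proof.
apply: fpsP => n; rewrite coef_fpsN coef_fps_twist coef_fpsX.
by have [->|_] := eqVneq n 1%N; rewrite ?mulr1 // mulr0 oppr0.
Qed.

End SignTwist.

Section LogarithmicDerivative.
Variable R : comUnitRingType.
Implicit Types a b : fps R.

(* The derivation t d/dt, which unlike d/dt preserves degrees. *)
Definition fps_theta a : fps R := Fps (fun n => a n *+ n).

Lemma coef_fps_theta a n : fps_theta a n = a n *+ n. Proof. by []. Qed.

Lemma fps_thetaM a b : fps_theta (a * b) = fps_theta a * b + a * fps_theta b.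
Proof.
apply: fpsP => n; rewrite coef_fpsD !coef_fpsM /= /fps_mul.
rewrite -sumrMnl -big_split /=.
apply: eq_bigr => i _; rewrite mulrnAl mulrnAr -mulrnDr.
by rewrite subnKC // -ltnS.
Qed.

Lemma fps_theta_twist a : fps_theta (fps_twist a) = fps_twist (fps_theta a).
Proof. by apply: fpsP => n /=; rewrite mulrnAr. Qed.

Definition fps_dlog a : fps R := fps_theta a / a.

Lemma fps_dlogM a b : a \is a GRing.unit -> b \is a GRing.unit ->
  fps_dlog (a * b) = fps_dlog a + fps_dlog b.
Proof.
move=> aU bU; have abU : a * b \is a GRing.unit by rewrite unitrM aU.
apply: (mulIr abU); rewrite divrK // fps_thetaM.
rewrite -{1}(divrK aU (fps_theta a)) -{1}(divrK bU (fps_theta b)) /fps_dlog.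
by ring.
Qed.

Lemma fps_dlog_twist a : a \is a GRing.unit ->
  fps_dlog (fps_twist a) = fps_twist (fps_dlog a).
Proof. by move=> aU; rewrite /fps_dlog rmorph_div // fps_theta_twist. Qed.

Lemma coef_fps_dlog_eq0 a d :
  (forall i, (0 < i <= d)%N -> a i = 0) -> fps_dlog a d = 0.
Proof.
move=> a0; rewrite coef_fpsM big1 // => -[[|i] /= lt_id] _.
  by rewrite mul0r.
by rewrite a0 ?mul0rn ?mul0r.
Qed.

Lemma coef_fps_geom k n : (0 < k)%N -> (1 - fpsX ^+ k)^-1 n = (k %| n)%:R :> R.
Proof.
move=> k0; pose geom : fps R := Fps (fun n => (k %| n)%:R).
have unit1BXk := @unit_fps_1BXn R _ k0.
suff -> : (1 - fpsX ^+ k)^-1 = geom by [].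
apply: (mulrI unit1BXk); rewrite mulrV //; apply: fpsP => {}n.
rewrite mulrBl mul1r coef_fpsD coef_fpsN coef_fpsXnM coef_fps1 /=.
case: ltnP => [lt_nk|le_kn]; last first.
  by rewrite dvdn_subl // subrr gtn_eqF // (leq_trans k0).
by rewrite subr0; case: n lt_nk => [|n] lt_nk; rewrite ?dvdn0 // gtnNdvd.
Qed.

Lemma coef_fps_dlog_1BXn k d : (0 < k)%N -> (0 < d)%N ->
  fps_dlog (1 - fpsX ^+ k) d = - (k * (k %| d))%:R :> R.
Proof.
move=> k0 d0; rewrite /fps_dlog; set u := 1 - fpsX ^+ k.
have uU : u \is a GRing.unit by apply: unit_fps_1BXn.
have -> : fps_theta u = (u - 1) *+ k.
  apply: fpsP => n; rewrite coef_fps_theta coef_fpsMn /u addrAC subrr add0r.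
  rewrite !(coef_fpsD, coef_fpsN) coef_fps1 coef_fpsXn.
  have [->|_] := eqVneq n k; first by rewrite (gtn_eqF k0) add0r.
  by case: n => [|n]; rewrite subr0 ?oppr0 !mul0rn.
rewrite mulrnAl mulrBl mulrV // mul1r coef_fpsMn coef_fpsD coef_fpsN coef_fps1.
by rewrite coef_fps_geom // (gtn_eqF d0) sub0r mulNrn natrM mulr_natl.
Qed.

End LogarithmicDerivative.

(** * Newton power sums as a logarithmic derivative *)

Lemma eq_psum d (x y : nat -> int) :
  (forall i, (0 < i <= d)%N -> x i = y i) -> psum d x = psum d y.
Proof. by move=> xy; apply: meval_eq => i; apply: xy; rewrite /= ltn_ord. Qed.

Definition psum_in (A : comNzRingType) (d : nat) (x : nat -> A) : A :=
  mmap intr (fun i : 'I_d => x i.+1) (newton_poly d).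

Lemma psum_inE d (x : nat -> int) : psum_in d x = psum d x.
Proof. by apply: eq_bigr => u _; rewrite intz. Qed.

Lemma rmorph_psum_in (A B : comNzRingType) (f : {rmorphism A -> B}) d x :
  f (psum_in d x) = psum_in d (f \o x).
Proof.
rewrite rmorph_sum; apply: eq_bigr => u _; rewrite rmorphM rmorph_int.
by rewrite rmorph_prod; congr (_ * _); apply: eq_bigr => i _; rewrite rmorphXn.
Qed.

Lemma psum_in_mesym M d : (0 < d <= M)%N ->
  psum_in d (mesym M int) = \sum_(j < M) 'X_j ^+ d.
Proof.
case/andP=> d0 dM; rewrite -(newton_polyP d0 dM).
apply: eq_bigr => u _; rewrite -[in RHS](intz (newton_poly d)@_u) rmorph_int.
by congr (_ * _); apply: eq_bigr => i _; rewrite tnth_mktuple.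
Qed.

(* Specializing 'X_i to x i.+1 gives x up to index M, and substituting the
   elementary symmetric polynomials, which is injective, gives mesym M. *)
Definition generic_seq (M k : nat) : {mpoly int[M]} :=
  if k is k'.+1 then if insub k' is Some i then 'X_i else 0 else 1.

Lemma comp_generic_seq M k :
  generic_seq M k \mPo [tuple mesym M int i.+1 | i < M] = mesym M int k.
Proof.
case: k => [|k]; first by rewrite comp_mpoly1 mesym0E.
rewrite /generic_seq; case: insubP => [i _ <-|].
  by rewrite comp_mpolyXU -tnth_nth tnth_mktuple.
by rewrite -leqNgt comp_mpoly0 => Mk; rewrite mesym_geqnE.
Qed.

Lemma meval_generic_seq M (x : nat -> int) k : x 0%N = 1 -> (k <= M)%N ->
  (generic_seq M k).@[fun i : 'I_M => x i.+1] = x k.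
Proof.
move=> x0; case: k => [|k] kM; first by rewrite meval1.
by rewrite /generic_seq insubT mevalXU.
Qed.

Lemma newton_identity_generic M k : (k < M)%N ->
  generic_seq M k.+1 *+ k.+1 =
  \sum_(i < k.+1)
    (-1) ^+ i * psum_in i.+1 (generic_seq M) * generic_seq M (k - i).
Proof.
move=> kM; apply: msym_fundamental_un.
set E := [tuple mesym M int i.+1 | i < M].
have generic_mesym : comp_mpoly E \o generic_seq M = mesym M int.
  by apply/funext => j; apply: comp_generic_seq.
rewrite comp_mpolyMn comp_generic_seq newton_identity raddf_sum.
apply: eq_bigr => i _ /=; rewrite !rmorphM rmorphXn rmorphN1 /= rmorph_psum_in.
rewrite generic_mesym comp_generic_seq psum_in_mesym //.
by rewrite (leq_trans (ltn_ord i)).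
Qed.

Lemma newton_identity_psum (x : nat -> int) k : x 0%N = 1 ->
  x k.+1 *+ k.+1 = \sum_(i < k.+1) (-1) ^+ i * psum i.+1 x * x (k - i)%N.
Proof.
move=> x0; pose v (i : 'I_k.+1) := x i.+1.
have /(congr1 (meval v)) := newton_identity_generic (ltnSn k).
rewrite mevalMn meval_generic_seq // => ->.
rewrite raddf_sum; apply: eq_bigr => i _; rewrite /= !mevalM rmorphXn rmorphN1.
rewrite meval_generic_seq ?(leq_trans (leq_subr _ _)) //; congr (_ * _ * _).
rewrite rmorph_psum_in psum_inE.
apply: eq_psum => j /andP[_ le_ji].
by rewrite /= meval_generic_seq // (leq_trans le_ji).
Qed.

Lemma coef_fps_dlog_psum (a : fps int) d : a 0%N = 1 -> (0 < d)%N ->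
  fps_dlog a d = (-1) ^+ d.+1 * psum d a.
Proof.
move=> a0; have aU := unit_fps1 a0.
pose q : fps int :=
  Fps (fun d => if d is 0 then 0 else (-1) ^+ d.+1 * psum d a).
suff -> : fps_dlog a = q by case: d.
apply: (mulIr aU); rewrite divrK //; apply: fpsP => -[|k].
  by rewrite coef_fps_theta coef_fpsM0 mul0r.
rewrite coef_fps_theta newton_identity_psum //.
rewrite coef_fpsM [RHS]big_ord_recl mul0r add0r.
by apply: eq_bigr => i _; rewrite /= !exprS !mulN1r opprK.
Qed.

(** * Moebius inversion *)

Lemma eq_big_divisors (R : Type) (idx : R) (op : R -> R -> R) N
    (F G : nat -> R) :
  (0 < N)%N -> (forall d, (0 < d <= N)%N -> F d = G d) ->
  \big[op/idx]_(d <- divisors N) F d = \big[op/idx]_(d <- divisors N) G d.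
Proof.
move=> N0 FG; rewrite big_seq [RHS]big_seq; apply: eq_bigr => d.
by rewrite -dvdn_divisors // => dN; rewrite FG // (dvdn_gt0 N0 dN) dvdn_leq.
Qed.

Lemma perm_divisors_dvd k n : (0 < n)%N -> (k %| n)%N ->
  perm_eq [seq d <- divisors n | (k %| d)%N]
          [seq (k * e)%N | e <- divisors (n %/ k)].
Proof.
move=> n0 kn; have k0 := dvdn_gt0 n0 kn.
have q0 : (0 < n %/ k)%N by rewrite divn_gt0 // dvdn_leq.
apply: uniq_perm; first by rewrite filter_uniq // divisors_uniq.
  rewrite map_inj_uniq ?divisors_uniq // => i j /eqP.
  by rewrite eqn_pmul2l // => /eqP.
move=> d; rewrite mem_filter -dvdn_divisors //; apply/andP/mapP => [[kd dn]|].
  exists (d %/ k)%N; last by rewrite mulnC divnK.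
  by rewrite -dvdn_divisors // -(dvdn_pmul2r k0) !divnK.
move=> [e]; rewrite -dvdn_divisors // => en ->; rewrite dvdn_mulr //.
by rewrite -(divnK kn) mulnC dvdn_pmul2r.
Qed.

Lemma perm_divisors_div n : (0 < n)%N ->
  perm_eq [seq (n %/ d)%N | d <- divisors n] (divisors n).
Proof.
move=> n0; have div_invol d : (d %| n)%N -> (n %/ (n %/ d))%N = d.
  by move=> dn; rewrite divnA // mulKn.
apply: uniq_perm; rewrite ?divisors_uniq //.
  rewrite map_inj_in_uniq ?divisors_uniq // => i j.
  by rewrite -!dvdn_divisors // => /div_invol {2}<- /div_invol {2}<- ->.
move=> d; rewrite -dvdn_divisors //; apply/mapP/idP => [[e]|dn].
  by rewrite -dvdn_divisors // => en ->; rewrite dvdn_div.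
by exists (n %/ d)%N; rewrite ?div_invol // -dvdn_divisors // dvdn_div.
Qed.

Lemma mobius_primeM p e : prime p -> (0 < e)%N ->
  mobius (p * e) = if (p %| e)%N then 0 else - mobius e.
Proof.
move=> pp e0; have p0 := prime_gt0 pp; rewrite /mobius muln_gt0 p0 e0 /=.
have logn_pM q : logn q (p * e) = ((q == p) + logn q e)%N.
  by rewrite lognM // logn_prime.
case: (boolP (p %| e)%N) => [pe|npe].
  rewrite ifF //; apply/negP => /allP/(_ p).
  have lpe : (0 < logn p e)%N by rewrite logn_gt0 mem_primes pp e0.
  rewrite mem_primes pp muln_gt0 p0 e0 dvdn_mulr // logn_pM eqxx => /(_ isT).
  by rewrite gtn_eqF.
have p_notin : p \notin primes e by rewrite mem_primes (negPf npe) !andbF.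
have primes_pM : perm_eq (primes (p * e)) (p :: primes e).
  apply: uniq_perm; rewrite /= ?primes_uniq ?p_notin //.
  by move=> q; rewrite primesM // primes_prime // !inE.
rewrite (perm_all _ primes_pM) (perm_size primes_pM) /= logn_pM eqxx.
rewrite (@eq_in_all _ _ (fun q => logn q e == 1%N)) => [|q qe]; last first.
  have /negPf q_neq_p : q != p by apply: contraNneq p_notin => <-.
  by rewrite logn_pM q_neq_p.
have -> : logn p e = 0%N by apply/eqP; rewrite -leqn0 leqNgt logn_gt0.
by case: all; rewrite ?oppr0 // exprS mulN1r.
Qed.

(* With p a prime factor of n, the divisors d and p d with p not dividing d
   cancel, and the others contribute 0. *)
Lemma sum_mobius n : (0 < n)%N ->
  \sum_(d <- divisors n) mobius d = (n == 1%N)%:R.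
Proof.
case: n => [|[|n]] // _; first by rewrite big_seq1.
set N := n.+2; have pp : prime (pdiv N) by rewrite pdiv_prime.
have pN : (pdiv N %| N)%N := pdiv_dvd N; set p := pdiv N in pp pN *.
have q0 : (0 < N %/ p)%N by rewrite divn_gt0 ?prime_gt0 // dvdn_leq.
have prime_to_p : perm_eq [seq d <- divisors N | ~~ (p %| d)%N]
                          [seq d <- divisors (N %/ p) | ~~ (p %| d)%N].
  apply: uniq_perm; rewrite ?filter_uniq ?divisors_uniq // => d.
  rewrite !mem_filter -!dvdn_divisors //; case: (boolP (p %| d)%N) => //= pd.
  rewrite -[X in (d %| X)%N](divnK pN) Gauss_dvdl //.
  by rewrite coprime_sym prime_coprime.
rewrite (bigID (dvdn p)) /= -big_filter -[X in _ + X]big_filter.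
rewrite (perm_big _ (perm_divisors_dvd _ pN)) // big_map.
rewrite (perm_big _ prime_to_p) /=.
rewrite big_filter [X in _ + X]big_mkcond -big_split big_seq big1 // => e.
rewrite -dvdn_divisors // => /(dvdn_gt0 q0) e0.
by rewrite mobius_primeM //; case: (p %| e)%N; rewrite /= ?addr0 ?addNr.
Qed.

Lemma sum_mobius_dvd N k : (0 < N)%N ->
  \sum_(d <- divisors N) mobius (N %/ d) * (k %| d)%N%:R = (N == k)%:R.
Proof.
move=> N0; under eq_bigr do rewrite mulr_natr mulrb.
rewrite -big_mkcond; have [kN|nkN] := boolP (k %| N)%N; last first.
  rewrite big_seq_cond big1 => [|d].
    by case: eqP nkN => // ->; rewrite dvdnn.
  rewrite -dvdn_divisors // => /andP[dN kd].
  by rewrite (dvdn_trans kd dN) in nkN.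
have k0 := dvdn_gt0 N0 kN.
have q0 : (0 < N %/ k)%N by rewrite divn_gt0 // dvdn_leq.
rewrite -big_filter (perm_big _ (perm_divisors_dvd N0 kN)) big_map.
under eq_bigr do rewrite divnMA.
rewrite -(big_map (divn (N %/ k)) predT mobius).
rewrite (perm_big _ (perm_divisors_div q0)) sum_mobius //.
by congr (nat_of_bool _)%:R; rewrite -(eqn_pmul2r k0) divnK // mul1n.
Qed.

(** * The exponents l_N *)

(* If a is the product of (1 + t^j)^(l_j) for odd j and (1 - t^j)^(- l_j) for
   even j, then witt_sum N a = N l_N: this is Witt's formula for the dimension
   l_N of the degree N part of a graded Lie superalgebra whose enveloping
   algebra has Hilbert series a. *)
Definition witt_sum (N : nat) (a : fps int) : int :=
  (-1) ^+ N * \sum_(d <- divisors N) mobius (N %/ d) * fps_dlog (fps_twist a) d.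

Section WittSum.
Variable N : nat.
Hypothesis N_gt0 : (0 < N)%N.
Implicit Types a b : fps int.

Lemma witt_sum_psum a : a 0%N = 1 ->
  witt_sum N a =
  (-1) ^+ N.+1 * \sum_(d <- divisors N) mobius (N %/ d) * psum d a.
Proof.
move=> a0; rewrite exprS mulN1r mulNr -mulrN -sumrN; congr (_ * _).
apply: eq_big_divisors => // d /andP[d0 _].
rewrite fps_dlog_twist ?unit_fps1 // coef_fps_twist coef_fps_dlog_psum //.
by rewrite exprS mulN1r mulNr mulrN signrMK mulrN.
Qed.

Lemma witt_sum_psum_twist a : a 0%N = 1 ->
  (-1) ^+ N * \sum_(d <- divisors N)
    mobius (N %/ d) * (-1) ^+ d * psum d (fps_twist a) = - witt_sum N a.
Proof.
move=> a0; rewrite -mulrN -sumrN; congr (_ * _).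
apply: eq_big_divisors => // d /andP[d0 _].
rewrite coef_fps_dlog_psum ?coef_fps_twist ?a0 //.
by rewrite exprS mulN1r mulNr mulrN opprK mulrA.
Qed.

Lemma witt_sumM a b : a \is a GRing.unit -> b \is a GRing.unit ->
  witt_sum N (a * b) = witt_sum N a + witt_sum N b.
Proof.
move=> aU bU; rewrite /witt_sum rmorphM fps_dlogM ?rmorph_unit //.
rewrite -mulrDr -big_split /=.
by congr (_ * _); apply: eq_bigr => d _; rewrite -mulrDr.
Qed.

Lemma witt_sum_eq0 a :
  (forall i, (0 < i <= N)%N -> a i = 0) -> witt_sum N a = 0.
Proof.
move=> a0; rewrite /witt_sum (eq_big_divisors _ _ N_gt0 (G := fun=> 0)).
  by rewrite big1 ?mulr0.
move=> d /andP[_ dN]; rewrite coef_fps_dlog_eq0 ?mulr0 // => i /andP[i0 id].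
by rewrite coef_fps_twist a0 ?mulr0 // i0 (leq_trans id).
Qed.

Lemma witt_sumV a : a \is a GRing.unit -> witt_sum N a^-1 = - witt_sum N a.
Proof.
move=> aU; apply/eqP; rewrite -addr_eq0 -witt_sumM ?unitrV // mulVr //.
by rewrite witt_sum_eq0 // => i /andP[i0 _]; rewrite coef_fps1 gtn_eqF.
Qed.

Lemma witt_sum_1BNXn k : (0 < k)%N ->
  witt_sum N (1 - (- fpsX) ^+ k) = (-1) ^+ k.+1 * (k * (N == k))%:R.
Proof.
move=> k0.
have twist_1BNXn : fps_twist (1 - (- fpsX) ^+ k) = 1 - fpsX ^+ k :> fps int.
  by rewrite rmorphB rmorph1 rmorphXn rmorphN /= fps_twistX opprK.
pose G d : int := - k%:R * (mobius (N %/ d) * (k %| d)%:R).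
rewrite /witt_sum twist_1BNXn (eq_big_divisors _ _ N_gt0 (G := G)).
  rewrite -mulr_sumr sum_mobius_dvd // natrM exprS.
  by case: eqP => [->|_]; [ring | rewrite !mulr0].
by move=> d /andP[d0 _]; rewrite coef_fps_dlog_1BXn // natrM /G; ring.
Qed.

Lemma witt_sum_1DXn_ge0 k : odd k -> 0 <= witt_sum N (1 + fpsX ^+ k).
Proof.
move=> k_odd; have := witt_sum_1BNXn (odd_gt0 k_odd).
rewrite (exprNn fpsX) exprS -(signr_odd (fps int)) -(signr_odd int) k_odd.
by rewrite !expr1 mulrNN mulN1r opprK !mul1r => ->; rewrite ler0n.
Qed.

Lemma witt_sum_1BXn_le0 k :
  (0 < k)%N -> ~~ odd k -> witt_sum N (1 - fpsX ^+ k) <= 0.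
Proof.
move=> k0 /negPf k_even; have := witt_sum_1BNXn k0.
rewrite (exprNn fpsX) exprS -(signr_odd (fps int)) -(signr_odd int) k_even.
by rewrite !expr0 !mul1r mulr1 mulN1r => ->; rewrite oppr_le0 ler0n.
Qed.

End WittSum.

Section NonnegSeries.
Variable R : numDomainType.
Implicit Types a b : fps R.

Definition fps_nneg : {pred fps R} :=
  [pred a : fps R | `[< forall n, 0 <= a n >]].

Lemma fps_nnegP a : reflect (forall n, 0 <= a n) (a \in fps_nneg).
Proof. exact: asboolP. Qed.

Lemma fps_nneg_addr_closed : addr_closed fps_nneg.
Proof.
split=> [|a b /fps_nnegP a0 /fps_nnegP b0]; apply/fps_nnegP => n //.
by rewrite coef_fpsD addr_ge0.
Qed.

Lemma fps_nneg_mulr_closed : mulr_closed fps_nneg.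
Proof.
split=> [|a b /fps_nnegP a0 /fps_nnegP b0]; apply/fps_nnegP => n.
  by rewrite coef_fps1 ler0n.
by rewrite coef_fpsM sumr_ge0 // => i _; rewrite mulr_ge0.
Qed.

HB.instance Definition _ :=
  GRing.isAddClosed.Build (fps R) fps_nneg fps_nneg_addr_closed.
HB.instance Definition _ :=
  GRing.isMulClosed.Build (fps R) fps_nneg fps_nneg_mulr_closed.

Lemma fps_nnegX : fpsX \in fps_nneg.
Proof. by apply/fps_nnegP => n; rewrite coef_fpsX ler0n. Qed.

Lemma fps_nneg_sub1 a : a \in fps_nneg -> 1 <= a 0%N -> a - 1 \in fps_nneg.
Proof.
move=> /fps_nnegP a_ge0 a0_ge1; apply/fps_nnegP => -[|n].
  by rewrite coef_fpsD coef_fpsN coef_fps1 subr_ge0.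
by rewrite coef_fpsD coef_fpsN coef_fps1 subr0.
Qed.

Lemma fps_nneg_inv1BXM a : a \in fps_nneg -> (1 - fpsX * a)^-1 \in fps_nneg.
Proof.
move=> /fps_nnegP a0; set b := _^-1; apply/fps_nnegP.
have bE : b = 1 + fpsX * (a * b).
  by rewrite -[X in X + _](mulrV (unit_fps_1BXM a)) -/b; ring.
elim/ltn_ind => -[|n] IHn; rewrite bE coef_fpsD coef_fps1 coef_fpsXM.
  by rewrite addr0 ler01.
rewrite add0r coef_fpsM sumr_ge0 // => i _.
by rewrite mulr_ge0 // IHn // ltnS leq_subr.
Qed.

End NonnegSeries.

Arguments fps_nneg {R}.

Lemma fps_nneg_split (a : fps int) : a \in fps_nneg ->
  exists (b : nat) (c : fps int), c \in fps_nneg /\ a = b%:R + fpsX * c.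
Proof.
move=> /fps_nnegP a0; exists `|a 0%N|%N, (Fps (fun n => a n.+1)).
split; first by apply/fps_nnegP => n; apply: a0.
apply: fpsP => -[|n]; rewrite coef_fpsD coef_fpsMn coef_fpsXM coef_fps1 /=.
  by rewrite addr0 natz gez0_abs.
by rewrite mul0rn add0r.
Qed.

Section LazardElimination.
Variable R : comUnitRingType.

(* The inverse of the Hilbert series of a free algebra with b generators of
   degree k.+1 and the others, counted by c, of degree at least k.+2. *)
Definition free_denom (k b : nat) (c : fps R) : fps R :=
  1 - fpsX ^+ k.+1 * (b%:R + fpsX * c).

(* Lazard elimination of a generator x of degree k.+1 replaces every other
   generator y by the generators (ad x)^i y. When k.+1 is odd, x generates a
   subalgebra in which [x, x] has degree 2 (k.+1); there we use only i <= 1 and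
   keep [x, x] as a new generator. *)
Lemma free_denom_mul1DXn k b c :
  free_denom k b.+1 c * (1 + fpsX ^+ k.+1) =
  free_denom k b (fpsX ^+ k * b.+1%:R + c * (1 + fpsX ^+ k.+1)).
Proof. by rewrite /free_denom -natr1 !exprS; ring. Qed.

Lemma free_denom_div1BXn k b c :
  free_denom k b.+1 c =
  (1 - fpsX ^+ k.+1) *
  free_denom k b ((fpsX ^+ k * b%:R + c) / (1 - fpsX ^+ k.+1)).
Proof.
rewrite /free_denom; set u := 1 - fpsX ^+ k.+1; set d := _ / u.
have du : d * u = fpsX ^+ k * b%:R + c by rewrite divrK ?unit_fps_1BXn.
transitivity (u - fpsX ^+ k.+1 * (b%:R * u + fpsX * (d * u))); last by ring.
by rewrite du /u -natr1 exprS; ring.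
Qed.

Lemma unit_free_denom k b c : free_denom k b c \is a GRing.unit.
Proof. by rewrite /free_denom exprS -mulrA unit_fps_1BXM. Qed.

End LazardElimination.

Section FreeWittSum.
Variable N : nat.
Hypothesis N_gt0 : (0 < N)%N.

Lemma witt_sum_free_denom_elim k b (c : fps int) : c \in fps_nneg ->
  exists2 c', c' \in fps_nneg &
    witt_sum N (free_denom k b.+1 c) <= witt_sum N (free_denom k b c').
Proof.
move=> c_nneg.
have nnegXn j : fpsX ^+ j \in @fps_nneg int by rewrite rpredX ?fps_nnegX.
have [k_odd|k_even] := boolP (odd k.+1).
  exists (fpsX ^+ k * b.+1%:R + c * (1 + fpsX ^+ k.+1)).
    by rewrite !(rpredD, rpredM, rpred_nat, rpred1).
  rewrite -free_denom_mul1DXn witt_sumM ?unit_free_denom //.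
    by rewrite lerDl witt_sum_1DXn_ge0.
  by rewrite unit_fps1 // coef_fpsD coef_fpsXn addr0.
exists ((fpsX ^+ k * b%:R + c) / (1 - fpsX ^+ k.+1)).
  by rewrite rpredM ?rpredD ?rpredM ?rpred_nat // exprS fps_nneg_inv1BXM.
rewrite [leLHS](congr1 (witt_sum N) (free_denom_div1BXn k b c)).
rewrite witt_sumM ?unit_free_denom ?unit_fps_1BXn //.
by rewrite gerDr witt_sum_1BXn_le0.
Qed.

(* By descending induction on k, and for each k by induction on the constant
   term of a, which counts the generators of degree k.+1. *)
Lemma witt_sum_1BXnM_le0 k (a : fps int) :
  a \in fps_nneg -> witt_sum N (1 - fpsX ^+ k.+1 * a) <= 0.
Proof.
have [j] := ubnP (N - k); elim: j k a => // j IHj k a; rewrite ltnS => le_Nkj.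
move=> a_nneg; have [le_Nk|lt_kN] := leqP N k.
  rewrite witt_sum_eq0 // => i /andP[i0 iN].
  rewrite coef_fpsD coef_fpsN coef_fps1 coef_fpsXnM (gtn_eqF i0).
  by rewrite ltnS (leq_trans iN le_Nk) subr0.
have [b [c [c_nneg ->]]] := fps_nneg_split a_nneg.
elim: b c c_nneg => [|b IHb] c c_nneg.
  by rewrite add0r mulrA -exprSr IHj // (leq_trans _ le_Nkj) // ltn_sub2l.
have [c' /IHb le_c'0 le_cc'] := witt_sum_free_denom_elim k b c_nneg.
exact: le_trans le_cc' le_c'0.
Qed.

Lemma witt_sum_1BXM_le0 (a : fps int) :
  a \in fps_nneg -> witt_sum N (1 - fpsX * a) <= 0.
Proof. by rewrite -[fpsX]expr1; apply: witt_sum_1BXnM_le0. Qed.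

End FreeWittSum.

(** * The face series of a flag complex *)

Section SimplexSum.
Variables (m : nat) (K : {set {set 'I_m}}).
Implicit Types (U h s : {set 'I_m}) (v w : 'I_m).

Definition simplex_sum (A : comNzRingType) (q : A) U : A :=
  \sum_(s in K | s \subset U) q ^+ #|s|.

Definition link_vertices v U := [set w in U | [set v; w] \in K].

Lemma link_vertices_sub v U : link_vertices v U \subset U.
Proof. by apply/subsetP => w; rewrite inE => /andP[]. Qed.

Lemma rmorph_simplex_sum (A B : comNzRingType) (f : {rmorphism A -> B}) q U :
  f (simplex_sum q U) = simplex_sum (f q) U.
Proof. by rewrite rmorph_sum; apply: eq_bigr => s _; rewrite rmorphXn. Qed.

Lemma simplex_sum_fvec (A : comNzRingType) (q : A) r :
  set0 \in K -> (forall s, s \in K -> (#|s| <= r)%N) ->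
  simplex_sum q setT = 1 + \sum_(i < r) q ^+ i.+1 *+ fvec K i.
Proof.
move=> K0 card_le; pose card_ord s : 'I_r.+1 := inord #|s|.
have card_ordE s j : s \in K -> (card_ord s == j) = (#|s| == j).
  by move=> sK; rewrite -val_eqE /= inordK // ltnS card_le.
rewrite /simplex_sum (eq_bigl (mem K)); last by move=> s; rewrite subsetT andbT.
rewrite (partition_big card_ord predT) //= big_ord_recl; congr (_ + _).
  rewrite (big_pred1 set0) ?cards0 // => s /=.
  apply/andP/eqP => [[sK]|->]; last by rewrite card_ordE // cards0.
  by rewrite card_ordE //= cards_eq0 => /eqP.
apply: eq_bigr => i _; rewrite /fvec -sumr_const.
apply: eq_big => [s|s /andP[sK]].
  by rewrite inE; case: (boolP (s \in K)) => //= sK; rewrite card_ordE.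
by rewrite card_ordE // => /eqP ->.
Qed.

Hypotheses (K_complex : simplicial_complex K) (K_flag : flag K).

Lemma flag_face s : {in s &, forall v w, [set v; w] \in K} -> s \in K.
Proof.
move=> pairs; apply/negPn/negP => sK.
have [t /minsetP[tK t_min] ts] :=
  @minset_exists _ (fun t : {set 'I_m} => t \notin K) _ sK.
have /K_flag/eqP/cards2P[v [w [_ tE]]] : minimal_nonface K t.
  split=> // u ut; apply/negPn/negP => /t_min/(_ (proper_sub ut)) uE.
  by rewrite uE properxx in ut.
case/negP: tK; rewrite tE; apply: pairs; apply: (subsetP ts);
  by rewrite tE !inE eqxx ?orbT.
Qed.

Lemma set0_face : set0 \in K.
Proof. by apply: flag_face => v w; rewrite inE. Qed.

Lemma flag_cone v U h : v \notin U ->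
  (v |: h \in K) && (h \subset U) = (h \in K) && (h \subset link_vertices v U).
Proof.
have [faceS vertexK] := K_complex => vU.
apply/andP/andP => [[vhK hU]|[hK h_link]]; split.
- exact: faceS vhK (subsetUr _ _).
- apply/subsetP => w wh; rewrite inE (subsetP hU) //=.
  by apply: faceS vhK _; rewrite subUset !sub1set !inE eqxx wh orbT.
- have link w : w \in h -> [set v; w] \in K.
    by move=> /(subsetP h_link); rewrite inE => /andP[].
  apply: flag_face => x y; rewrite !inE => /predU1P[->|xh] /predU1P[->|yh].
  + by rewrite setUid.
  + exact: link.
  + by rewrite setUC; apply: link.
  + by apply: faceS hK _; rewrite subUset !sub1set xh.
- exact: subset_trans h_link (link_vertices_sub v U).
Qed.

Lemma simplex_sumD1 (A : comNzRingType) (q : A) U v : v \in U ->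
  simplex_sum q U =
  simplex_sum q (U :\ v) + q * simplex_sum q (link_vertices v (U :\ v)).
Proof.
move=> vU; rewrite /simplex_sum (bigID (fun s => v \in s)) /= addrC.
congr (_ + _).
  by apply: eq_bigl => s; rewrite subsetD1 andbA.
rewrite mulr_sumr (reindex_onto (fun h => v |: h) (fun h => h :\ v)) /=;
  last first.
  by move=> h /andP[_ vh]; rewrite setD1K.
apply: eq_big => [h|h /andP[_ /eqP hv]]; last first.
  by rewrite cardsU1 -hv setD11 exprS.
rewrite -flag_cone ?setD11 // subUset sub1set vU setU11 subsetD1 /=.
rewrite !andbT -!andbA; congr (_ && (_ && _)).
apply/eqP/idP => [<-|vh]; first by rewrite setD11.
by rewrite setU1K.
Qed.

Lemma simplex_sum_set0 (A : comNzRingType) (q : A) : simplex_sum q set0 = 1.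
Proof.
rewrite /simplex_sum (big_pred1 set0) ?cards0 // => s.
by rewrite subset0 /=; case: eqP => [->|]; rewrite ?set0_face ?andbF.
Qed.

Lemma coef_simplex_sum0 (R : comUnitRingType) (q : fps R) U :
  q 0%N = 0 -> simplex_sum q U 0%N = 1.
Proof.
move=> q0; rewrite coef_fps_sum (bigD1 set0) ?set0_face ?sub0set //=.
rewrite cards0 expr0 big1 ?addr0 // => s /andP[_]; rewrite -card_gt0.
by case: #|s| => // j _; rewrite exprS coef_fpsM0 q0 mul0r.
Qed.

Definition face_series U : fps int := simplex_sum (- (fpsX / (1 + fpsX))) U.

Lemma face_series0 U : face_series U 0%N = 1.
Proof.
by apply: coef_simplex_sum0; rewrite coef_fpsN coef_fpsM0 coef_fpsX mul0r oppr0.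
Qed.

Lemma unit_face_series U : face_series U \is a GRing.unit.
Proof. by rewrite unit_fps1 ?face_series0. Qed.

Lemma face_series_factor U v : v \in U ->
  face_series (link_vertices v (U :\ v)) / face_series (U :\ v) \in fps_nneg ->
  exists2 B, B \in fps_nneg &
    (1 + fpsX) * face_series U = face_series (U :\ v) * (1 - fpsX * B).
Proof.
set L := link_vertices v _; set F := face_series (U :\ v); set H := _ / F.
move=> vU H_nneg; have HF : H * F = face_series L.
  by rewrite divrK ?unit_face_series.
exists (H - 1).
  by rewrite fps_nneg_sub1 // coef_fpsM0 coef_fpsV0 !face_series0 divr1.
have -> : face_series U = F - fpsX / (1 + fpsX) * (H * F).
  by rewrite HF -mulNr; apply: simplex_sumD1.
transitivity ((1 + fpsX - fpsX / (1 + fpsX) * (1 + fpsX) * H) * F).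
  by ring.
by rewrite divrK ?unit_fps_1DX //; ring.
Qed.

Lemma face_series_ratio_nneg U s :
  s \subset U -> face_series s / face_series U \in fps_nneg.
Proof.
have [c] := ubnP #|U|; elim: c => // c IHc in U s *; rewrite ltnS => Uc sU.
have [Us|] := boolP (U \subset s).
  have -> : s = U by apply/eqP; rewrite eqEsubset sU Us.
  by rewrite mulrV ?unit_face_series // rpred1.
case/subsetPn=> v vU vs.
have Uv_lt : (#|U :\ v| < c)%N by rewrite (cardsD1 v) vU in Uc.
have s_ratio : face_series s / face_series (U :\ v) \in fps_nneg.
  by rewrite IHc // subsetD1 sU.
have link_ratio := IHc _ _ Uv_lt (link_vertices_sub v _).
have [B B_nneg FU] := face_series_factor vU link_ratio.
have -> : face_series s / face_series U =
    face_series s / face_series (U :\ v) * (1 - fpsX * B)^-1 * (1 + fpsX).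
  apply: (mulIr (unit_face_series U)); rewrite divrK ?unit_face_series //.
  rewrite -[RHS]mulrA FU [RHS]mulrACA divrK ?unit_face_series //.
  by rewrite mulVr ?unit_fps_1BXM // mulr1.
by rewrite rpredM ?rpredD ?rpred1 ?fps_nnegX // rpredM // fps_nneg_inv1BXM.
Qed.

Lemma witt_sum_face_series_le0 N U :
  (0 < N)%N -> witt_sum N (face_series U) <= 0.
Proof.
move=> N0; have [c] := ubnP #|U|; elim: c => // c IHc in U *.
rewrite ltnS => Uc.
have [->|[v vU]] := set_0Vmem U.
  rewrite /face_series simplex_sum_set0 witt_sum_eq0 // => i /andP[i0 _].
  by rewrite coef_fps1 gtn_eqF.
have /IHc IHv : (#|U :\ v| < c)%N by rewrite (cardsD1 v) vU in Uc.
have link_ratio := face_series_ratio_nneg (link_vertices_sub v (U :\ v)).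
have [B B_nneg /(congr1 (witt_sum N))] := face_series_factor vU link_ratio.
rewrite !witt_sumM ?unit_face_series ?unit_fps_1BXM ?unit_fps_1DX // => sumE.
have := witt_sum_1DXn_ge0 N0 (isT : odd 1); rewrite expr1 => ge0.
rewrite -(lerD2l (witt_sum N (1 + fpsX))) sumE addr0 (le_trans _ ge0) //.
by rewrite -[leRHS]addr0 lerD // (witt_sum_1BXM_le0 N0).
Qed.

End SimplexSum.

(** * The sequences s and alpha *)

Lemma fseriesE (m : nat) (K : {set {set 'I_m}}) (n : nat) :
  set0 \in K -> complex_dim K n -> Fps (fseries K n) = face_series K setT.
Proof.
move=> K0 dimK; have card_le (s : {set 'I_m}) : s \in K -> (#|s| <= n.+1)%N.
  move=> sK; rewrite -dimK.
  exact: (leq_bigmax_cond (F := fun t : {set 'I_m} => #|t|)).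
rewrite /face_series (simplex_sum_fvec _ K0 card_le).
apply: fpsP => k; rewrite coef_fpsD coef_fps_sum coef_fps1.
rewrite [LHS]/fseries {1}/fps_poly coef1; congr (_ + _); apply: eq_bigr => i _.
set P := (1 + 'X) ^+ i.+1; set V := fps_inv _.
have fps_of_P : fps_of_poly P = (1 + fpsX) ^+ i.+1 :> fps int.
  by rewrite rmorphXn rmorphD rmorph1.
have -> : fps_mul (fps_poly 'X^(i.+1)) V k = ((fpsX / (1 + fpsX)) ^+ i.+1) k.
  rewrite exprMn exprVn -fps_of_P fps_invE; last first.
    by rewrite fps_of_P unitrX ?unit_fps_1DX.
  by rewrite -rmorphXn.
rewrite (exprNn (fpsX / _)) coef_fpsMn -mulr_natr natz mulrAC; congr (_ * _).
rewrite -(signr_odd int) -(signr_odd (fps int)).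
by case: odd; rewrite ?expr1 ?mulN1r ?expr0 ?mul1r.
Qed.

Lemma sseqE (m : nat) (K : {set {set 'I_m}}) (n : nat) :
  set0 \in K -> complex_dim K n -> Fps (sseq K n) = (face_series K setT)^-1.
Proof.
move=> K0 dimK; rewrite -(fseriesE K0 dimK) fps_invE // unit_fps1 //.
exact: fseries0.
Qed.

Lemma coef_exp_fpsX_div1BX (R : comUnitRingType) i j :
  ((fpsX / (1 - fpsX)) ^+ i.+1) j.+1 = 'C(j, i)%:R :> R.
Proof.
set q := fpsX / (1 - fpsX).
have unit1BX : 1 - fpsX \is a @GRing.unit (fps R).
  by rewrite -[fpsX]expr1 unit_fps_1BXn.
have qE : q = fpsX * (1 + q).
  apply: (mulIr unit1BX); rewrite divrK //.
  transitivity (fpsX * ((1 - fpsX) + q * (1 - fpsX))); last by ring.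
  by rewrite divrK //; ring.
have coef_rec n d : (q ^+ n.+1) d.+1 = (q ^+ n) d + (q ^+ n.+1) d :> R.
  rewrite {1}exprS {1}qE mulrAC -mulrA coef_fpsXM.
  by rewrite mulrDr mulr1 -exprSr coef_fpsD.
have coef_qX0 n : (q ^+ n.+1) 0%N = 0 :> R.
  by rewrite exprS coef_fpsM0 coef_fpsM0 coef_fpsX !mul0r.
elim: j i => [|j IHj] [|i]; rewrite coef_rec ?IHj.
- by rewrite coef_qX0 addr0.
- by rewrite !coef_qX0 addr0.
- by rewrite expr0 coef_fps1 add0r !bin0.
- by rewrite binS addnC natrD.
Qed.

Lemma coef_fps_twist_face_series (m : nat) (K : {set {set 'I_m}}) k :
  set0 \in K -> (0 < k)%N -> fps_twist (face_series K setT) k = (alpha K k)%:Z.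
Proof.
case: k => // k K0 _; have -> : fps_twist (face_series K setT) =
    simplex_sum K (fpsX / (1 - fpsX)) setT.
  rewrite rmorph_simplex_sum; congr simplex_sum.
  rewrite rmorphN rmorph_div ?unit_fps_1DX // rmorphD rmorph1 /= fps_twistX.
  by rewrite mulNr opprK.
rewrite (simplex_sum_fvec _ (r := k.+1 + m)) // => [|s _]; last first.
  by rewrite (leq_trans (max_card _)) // card_ord leq_addl.
rewrite coef_fpsD coef_fps1 add0r coef_fps_sum big_split_ord /=.
rewrite [X in _ + X]big1 ?addr0 => [|i _]; last first.
  by rewrite coef_fpsMn coef_exp_fpsX_div1BX bin_small ?mul0rn // ltnS leq_addr.
rewrite /alpha -natz natr_sum; apply: eq_bigr => i _.
by rewrite coef_fpsMn coef_exp_fpsX_div1BX natrM mulr_natl.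
Qed.

Theorem mainTheorem4 (m : nat) (K : {set {set 'I_m}}) (n : nat)
    (hK : simplicial_complex K) (hflag : flag K) (hdim : complex_dim K n)
    (N : nat) (hN : (1 <= N)%N) :
  0 <= (-1) ^+ N.+1 *
       \sum_(d <- divisors N) mobius (N %/ d) * psum d (sseq K n)
  /\
  0 <= (-1) ^+ N *
       \sum_(d <- divisors N) mobius (N %/ d) * (-1) ^+ d *
         psum d (fun k => (alpha K k)%:Z).
Proof.
have K0 := set0_face hflag; pose F := face_series K setT.
have witt_ge0 : 0 <= - witt_sum N F.
  by rewrite oppr_ge0 witt_sum_face_series_le0.
have S0 : Fps (sseq K n) 0%N = 1 := sseq0 K n.
split.
  by rewrite -(witt_sum_psum hN S0) sseqE // witt_sumV ?unit_face_series.
congr (0 <= _): witt_ge0; rewrite -witt_sum_psum_twist ?face_series0 //.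
congr (_ * _); apply: eq_big_divisors => // d _; congr (_ * _).
by apply: eq_psum => i /andP[i0 _]; rewrite coef_fps_twist_face_series.
Qed.
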